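(* Let $n\ge 2$ and $S=SL_n(\mathbb{C})$. Any two tame sequences in $S$ are equivalent: if $(A(k))_{k\in\mathbb{N}}$ and $(B(k))_{k\in\mathbb{N}}$ are sequences of pairwise distinct elements of $S$ such that $\{A(k):k\in\mathbb{N}\}$ and $\{B(k):k\in\mathbb{N}\}$ are tame discrete subsets of $S$, then there exists a holomorphic automorphism $\phi$ of the complex manifold $S$ such that $\phi(A(k))=B(k)$ for all $k\in\mathbb{N}$.
   Context: A discrete subset of a complex manifold $X$ is a subset without accumulation points in $X$. An automorphism of $X$ is a biholomorphic self-map of the complex manifold $X$ (not necessarily a group homomorphism when $X$ is a Lie group). An exhaustion function on $X$ is a continuous function $\rho:X\to\mathbb{R}^+$ (non-negative reals) all of whose sublevel sets $\{x\in X:\rho(x)\le c\}$ are compact. An infinite discrete subset $D\subset X$ is called tame if for every exhaustion function $\rho:X\to\mathbb{R}^+$ and every map $\zeta:D\to\mathbb{R}^+$ there exists an automorphism $\phi$ of $X$ such that $\rho(\phi(x))\ge\zeta(x)$ for all $x\in D$. *)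

(* Defs.v *)
(* The complex field is R[i], with R : realType the reals. *)
From HB Require Import structures.
From mathcomp Require Import all_boot all_order all_algebra.
From mathcomp Require Import all_classical all_reals all_analysis.
From mathcomp Require Import complex.
Set Implicit Arguments.
Unset Strict Implicit.
Unset Printing Implicit Defensive.
Import Order.TTheory GRing.Theory Num.Theory.
Import numFieldNormedType.Exports.
Local Open Scope classical_set_scope.
Local Open Scope ring_scope.
Local Open Scope complex_scope.

(* A complex manifold is represented here as a closed complex submanifold X of
   a finite-dimensional complex normed space V; a map on X is a function
   on V of which only the values on X matter. *)

(* Holomorphy on a submanifold X: f|X extends, locally around each point of X,
   to a holomorphic map between the ambient spaces.  [differentiable] is Frechet
   differentiability over the scalar field R[i], i.e. complex differentiability. *)
Definition holomorphic_on (R : realType) (V W : normedModType R[i])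
    (X : set V) (f : V -> W) : Prop :=
  forall p, X p -> exists (U : set V) (F : V -> W),
    [/\ open U, U p, (forall x, U x -> differentiable F x)
      & forall x, U x -> X x -> F x = f x].

Definition is_automorphism (R : realType) (V : normedModType R[i])
    (X : set V) (phi : V -> V) : Prop :=
  exists psi : V -> V,
    [/\ set_fun X X phi, set_fun X X psi,
        (forall x, X x -> psi (phi x) = x),
        (forall x, X x -> phi (psi x) = x)
      & holomorphic_on X phi /\ holomorphic_on X psi].

Definition discrete_subset (V : topologicalType) (X D : set V) : Prop :=
  D `<=` X /\ X `&` limit_point D = set0.

Definition is_exhaustion (R : realType) (V : topologicalType)
    (X : set V) (rho : V -> R) : Prop :=
  [/\ {within X, continuous rho}, (forall x, X x -> 0 <= rho x)
    & forall c : R, compact [set x | X x /\ rho x <= c]].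

Definition tame (R : realType) (V : normedModType R[i]) (X D : set V) : Prop :=
  [/\ infinite_set D, discrete_subset X D
    & forall (rho : V -> R) (zeta : V -> R),
        is_exhaustion X rho -> (forall x, D x -> 0 <= zeta x) ->
        exists phi : V -> V,
          is_automorphism X phi /\ forall x, D x -> zeta x <= rho (phi x)].

(* The topology of 'M[R[i]]_n is the usual one (sup norm of the entries). *)
Definition SL (R : realType) (n : nat) : set 'M[R[i]]_n :=
  [set A | \det A = 1].
Arguments SL : clear implicits.

(* Main.v *)
Require Import Defs.
From HB Require Import structures.
From mathcomp Require Import all_boot all_order all_algebra.
From mathcomp Require Import all_classical all_reals all_analysis.
From mathcomp Require Import complex.
From mathcomp Require Import perm ring zify.
Set Implicit Arguments.
Unset Strict Implicit.
Unset Printing Implicit Defensive.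
Import Order.TTheory GRing.Theory Num.Theory.
Import numFieldNormedType.Exports.
Local Open Scope classical_set_scope.
Local Open Scope ring_scope.
Local Open Scope complex_scope.

(** The idea.  Let x_k be a sequence of distinct complex numbers tending to
    infinity.  An entire function can be prescribed arbitrarily on the x_k
    ([interpolation]).  Hence, if x_k is the entry in position (0, 0) of A(k),
    one can add to each row of A(k) other than row 0 multiples of other rows,
    with coefficients chosen independently for every k: the coefficients are
    entire functions of the (0, 0) entry, which such an operation does not
    change, so the operation is undone by the opposite one and is a holomorphic
    automorphism of SL_n ([shear_equivalent]).  The same holds for columns,
    since transposition is an automorphism.

    These operations generate a lot.  A Gaussian elimination whose number of
    steps does not depend on the matrix shows that A(k) can be multiplied on
    the left by any g(k) in SL_n whose row 0 is that of the identity
    ([moves_unit_rows]).  Consequently the sequence A is determined, up to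
    automorphism, by its (0, 0) entries x_k ([corner_determines]).  To compare
    two sequences with distinct corners x_k and y_k, first give them the entries
    y_k - x_k and 0 in position (1, 0), then add row 1 to row 0: both corners
    become y_k ([corner_equivalent]).

    It remains to bring a tame sequence to one whose (0, 0) entries are distinct
    and tend to infinity.  Tameness, for the exhaustion given by the norm,
    makes the norms of the A(k) grow as fast as desired.  A quantitative genericity
    argument provides vectors u and v for which |u A(k) v| is at least the norm of
    A(k) times a positive factor that depends on k only and not on the matrices
    ([generic_functional], [generic_corner]).  This independence is what
    allows the growth to be prescribed beforehand, and it also gives
    u (A(k) - A(l)) v <> 0 for k <> l. *)

Local Notation Re := complex.Re.
Local Notation Im := complex.Im.

(** * Majorants and Taylor estimates for polynomials *)

Section Dominated.
Variable K : numFieldType.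
Implicit Types (p q P Q : {poly K}) (z h : K).

(** The majorant relation of Cauchy.  It survives products and derivatives, so that
    bounds on q and on its Taylor remainders are read off from values of P at
    nonnegative points. *)
Definition dominated P q := forall i, `|q`_i| <= P`_i.

Lemma dominated1 : dominated 1 1.
Proof. by move=> i; rewrite coef1 normr_nat. Qed.

Lemma dominatedC a : dominated (`|a|%:P) a%:P.
Proof. by move=> i; rewrite !coefC; case: ifP; rewrite ?normr0. Qed.

Lemma dominatedXsubC a : dominated ('X + `|a|%:P) ('X - a%:P).
Proof.
move=> i; rewrite coefB coefD; apply: (le_trans (ler_normB _ _)).
by rewrite !coefX normr_nat lerD2l; exact: dominatedC.
Qed.

Lemma dominatedX : dominated 'X 'X.
Proof. by move=> i; rewrite coefX normr_nat. Qed.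

Lemma dominatedM P q P' q' :
  dominated P q -> dominated P' q' -> dominated (P * P') (q * q').
Proof.
move=> Pq Pq' i; rewrite !coefM; apply: (le_trans (ler_norm_sum _ _ _)).
by apply: ler_sum => j _; rewrite normrM ler_pM.
Qed.

Lemma dominatedX_exp P q n : dominated P q -> dominated (P ^+ n) (q ^+ n).
Proof.
by move=> Pq; elim: n => [|n IHn]; [exact: dominated1|rewrite !exprS; exact: dominatedM].
Qed.

Lemma dominated_prod (n : nat) (P q : nat -> {poly K}) :
  (forall j, dominated (P j) (q j)) ->
  dominated (\prod_(j < n) P j) (\prod_(j < n) q j).
Proof.
move=> Pq; elim: n => [|n IHn]; first by rewrite !big_ord0; exact: dominated1.
by rewrite !big_ord_recr /=; exact: dominatedM.
Qed.

Lemma dominated_horner P q z : dominated P q -> `|q.[z]| <= P.[`|z|].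
Proof.
move=> Pq; pose n := maxn (size P) (size q).
rewrite (@horner_coef_wide _ n q) ?leq_maxr// (@horner_coef_wide _ n P) ?leq_maxl//.
apply: (le_trans (ler_norm_sum _ _ _)); apply: ler_sum => i _.
by rewrite normrM normrX ler_wpM2r ?exprn_ge0.
Qed.

Lemma dominated_nderivn P q n : dominated P q -> dominated P^`N(n) q^`N(n).
Proof.
by move=> Pq i; rewrite !coef_nderivn normrMn lerMn2r Pq orbT.
Qed.

(** In the Taylor expansion of q at z the terms of degree at least 2 in h are at
    most |h|^2 times the corresponding terms of P at |z| with increment 1. *)
Lemma dominated_taylor P q z h : dominated P q -> `|h| <= 1 ->
  `|q.[z + h] - q.[z] - q^`().[z] * h| <= P.[`|z| + 1] * `|h| ^+ 2.
Proof.
move=> Pq h1; pose n := (maxn (size P) (size q)).+2.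
have sq : (size q <= n)%N by rewrite /n !leqW// leq_maxr.
have sP : (size P <= n)%N by rewrite /n !leqW// leq_maxl.
rewrite (nderiv_taylor_wide (mulrC _ _) sq) (nderiv_taylor_wide (mulrC _ _) sP).
rewrite /n big_ord_recl big_ord_recl /= nderivn0 expr0 mulr1 nderivn1 expr1.
rewrite (_ : forall a b c : K, a + (b + c) - a - b = c); last by move=> a b c; ring.
apply: (le_trans (ler_norm_sum _ _ _)).
have pos i : 0 <= P^`N(i).[`|z|] by apply: le_trans (dominated_horner z (dominated_nderivn i Pq)).
rewrite [X in _ <= X * _]big_ord_recl [X in _ <= (_ + X) * _]big_ord_recl addrA.
rewrite mulrDl -[leLHS]add0r; apply: lerD.
  by rewrite mulr_ge0 ?exprn_ge0// addr_ge0// mulr_ge0// ?exprn_ge0.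
rewrite mulr_suml; apply: ler_sum => i _.
rewrite expr1n mulr1 normrM ler_pM//.
  exact: dominated_horner (dominated_nderivn _ Pq).
rewrite /bump /= !add1n normrX; set k : nat := i.
by rewrite -[k.+2]addn2 exprD ler_piMl// ?exprn_ge0// exprn_ile1.
Qed.

Lemma dominated_deriv P q z : dominated P q ->
  `|q^`().[z]| <= P.[`|z| + 1].
Proof.
move=> Pq; pose n := (size P).+2.
have sP : (size P <= n)%N by rewrite /n !leqW.
rewrite (nderiv_taylor_wide (mulrC _ _) sP).
have pos i : 0 <= P^`N(i).[`|z|] by apply: le_trans (dominated_horner z (dominated_nderivn i Pq)).
rewrite /n big_ord_recl big_ord_recl /= expr1n mulr1 -nderivn1.
rewrite expr1n mulr1 addrCA.
apply: (le_trans (dominated_horner z (dominated_nderivn 1 Pq))).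
rewrite lerDl addr_ge0// sumr_ge0// => i _; rewrite mulr_ge0// ?exprn_ge0.
Qed.

(** Complex differentiability with a quadratic remainder: this form of the
    derivative passes to the limit in a series of functions. *)
Lemma differentiable_quadratic (F : K -> K) (z D C : K) :
  (forall h, `|h| <= 1 -> `|F (z + h) - F z - D * h| <= C * `|h| ^+ 2) ->
  differentiable F z.
Proof.
move=> FD; apply/derivable1_diffP.
have C0 : 0 <= C.
  by have := FD 1; rewrite normr1 lexx expr1n !mulr1 => /(_ isT); exact: le_trans.
apply/cvg_ex; exists D; apply/cvgrPdist_le => e e0.
have C1 : 0 < C + 1 by rewrite ltr_wpDl.
near=> h.
have h0 : h != 0 by near: h; exact: nbhs_dnbhs_neq.
have h1 : `|h| <= 1 by near: h; exact: dnbhs0_le.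
have h2 : `|h| <= e / (C + 1) by near: h; apply: dnbhs0_le; rewrite divr_gt0.
rewrite distrC /= [h%:A]mulr1 [h + z]addrC.
rewrite (_ : _ - D = h^-1 * (F (z + h) - F z - D * h)); last first.
  by rewrite mulrBr [D * h]mulrC mulKf.
rewrite normrM normfV ler_pdivrMl ?normr_gt0// [leRHS]mulrC.
apply: (le_trans (FD _ h1)); rewrite expr2 mulrA ler_wpM2r//.
rewrite ler_pdivlMr// in h2; apply: le_trans h2.
by rewrite mulrC ler_wpM2l// lerDl.
Unshelve. all: by end_near.
Qed.

End Dominated.

(** * Interpolation by entire functions *)

Section Interpolation.
Variable R : realType.
Local Notation K := (R[i] : numFieldType).

Lemma norm_Re_le (z : K) (m : R) : `|z| <= m%:C -> `|Re z| <= m.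
Proof. by move=> zm; rewrite -lecR; apply: le_trans zm; exact: normc_ge_Re. Qed.

Lemma normci : `|'i%C| = 1 :> K.
Proof. by rewrite normc_def /= expr0n expr1n add0r sqrtr1. Qed.

Lemma norm_Im_le (z : K) (m : R) : `|z| <= m%:C -> `|Im z| <= m.
Proof.
move=> zm; rewrite -normrN -ReiNIm; apply: norm_Re_le.
by rewrite normrM normci mulr1.
Qed.

Lemma norm_ReIm_le (z : K) : `|z| <= (`|Re z| + `|Im z|)%:C.
Proof.
rewrite {1}[z]complexE; apply: (le_trans (ler_normD _ _)).
rewrite normrM normci mul1r.
by rewrite !normc_def /= !expr0n !addr0 !sqrtr_sqr raddfD.
Qed.

Lemma complex_cvg (u : nat -> K) (S : K) :
  (fun n => Re (u n)) @ \oo --> Re S -> (fun n => Im (u n)) @ \oo --> Im S ->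
  u @ \oo --> S.
Proof.
move=> uRe uIm; apply/cvgrPdist_le => e e0.
have er : e = (Re e)%:C by rewrite RRe_real// gtr0_real.
have e20 : 0 < Re e / 2 by rewrite divr_gt0// -ltcR -er.
near=> n.
apply: (le_trans (norm_ReIm_le _)); rewrite er lecR (splitr (Re e)) !raddfB lerD//.
  by near: n; move/cvgrPdist_le : uRe; apply.
by near: n; move/cvgrPdist_le : uIm; apply.
Unshelve. all: by end_near. Qed.

(** Real and imaginary parts converge absolutely, by comparison in R. *)
Lemma norm_series_cvg (t : nat -> K) (m : nat -> R) :
  (forall k, `|t k| <= (m k)%:C) -> cvgn (series m) ->
  exists S : K, (series t : nat -> K) @ \oo --> S.
Proof.
move=> tm cm.
have m0 k : 0 <= m k by rewrite -ler0c; apply: le_trans (tm k).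
have cv (f : nat -> R) : (forall k, `|f k| <= m k) -> cvgn (series f).
  move=> fm; apply: normed_cvg; apply: series_le_cvg cm => // k; exact: normr_ge0.
have /cv cRe : forall k, `|Re (t k)| <= m k by move=> k; exact: norm_Re_le.
have /cv cIm : forall k, `|Im (t k)| <= m k by move=> k; exact: norm_Im_le.
exists (limn (series (fun k => Re (t k))) +i* limn (series (fun k => Im (t k)))).
apply: complex_cvg => /=.
  rewrite (_ : (fun n => _) = series (fun k => Re (t k)))//.
  by apply/funext => n; rewrite /series /= raddf_sum.
rewrite (_ : (fun n => _) = series (fun k => Im (t k)))//.
by apply/funext => n; rewrite /series /= raddf_sum.
Qed.

Lemma norm_lim_le (u : nat -> K) (S B : K) :
  u @ \oo --> S -> (forall n, `|u n| <= B) -> `|S| <= B.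
Proof.
move=> uS uB.
have B0 : 0 <= B := le_trans (normr_ge0 _) (uB 0).
rewrite -(RRe_real (normr_real S)) -(RRe_real (ger0_real B0)) lecR.
apply/ler_addgt0Pr => e e0; rewrite -lecR (RRe_real (normr_real S)) raddfD /=.
rewrite (RRe_real (ger0_real B0)).
have : \forall n \near \oo, `|S - u n| <= e%:C.
  by move/cvgrPdist_le : uS; apply; rewrite ltcR.
move=> [n _ /(_ n (leqnn n))] /= Sn.
rewrite -[S](subrK (u n)) addrC; apply: (le_trans (ler_normD _ _)).
by rewrite lerD.
Qed.

(** A normalized form of |x k| -> oo: the rate k + 1 also gives x k <> 0, and
    tameness is strong enough to impose it. *)
Definition escaping (x : nat -> K) :=
  injective x /\ forall k, k.+1%:R <= `|x k|.

Lemma escaping_neq0 x k : escaping x -> x k != 0.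
Proof. by move=> [_ /(_ k) xk]; rewrite -normr_gt0; apply: lt_le_trans xk. Qed.

(** One term of a Newton interpolation series.  The factors X - x_j leave the
    values at the previous nodes unchanged; the factor (X / x_k)^m has value 1
    at x_k, and for m large it makes the term small on the disc of radius
    |x_k| / 2, which gives convergence on compact sets. *)
Lemma newton_term (x : nat -> K) (k : nat) (a : K) :
  injective x -> x k != 0 ->
  exists q P : {poly K}, [/\ dominated P q, q.[x k] = a,
    (forall j, (j < k)%N -> q.[x j] = 0)
    & forall r, 0 <= r -> r *+ 2 <= `|x k| -> P.[r] <= 2^-1 ^+ k].
Proof.
move=> injx xk0.
pose B : K := `|a| * \prod_(j < k) (`|(x k - x j)^-1| * (`|x k| + `|x j|)).
have B0 : 0 <= B by rewrite mulr_ge0// prodr_ge0// => j _; rewrite mulr_ge0// addr_ge0.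
pose m := (k + Num.bound (Re B))%N.
have Bm : B * 2^-1 ^+ m <= 2^-1 ^+ k.
  rewrite /m exprD mulrCA ler_piMr ?exprn_ge0 ?invr_ge0//.
  rewrite exprVn ler_pdivrMr ?exprn_gt0// mul1r.
  have : Re B <= (2 ^ Num.bound (Re B))%:R.
    apply: le_trans (ltW (archi_boundP _)) _; first by rewrite -ler0c RRe_real// ger0_real.
    by rewrite ler_nat ltnW// ltn_expl.
  by rewrite -lecR RRe_real ?ger0_real// rmorph_nat natrX.
pose q := a%:P * ((x k)^-1%:P * 'X) ^+ m *
  \prod_(j < k) ((x k - x j)^-1%:P * ('X - (x j)%:P)).
pose P := `|a|%:P * (`|(x k)^-1|%:P * 'X) ^+ m *
  \prod_(j < k) (`|(x k - x j)^-1|%:P * ('X + `|x j|%:P)).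
exists q, P; split.
- apply: dominatedM; first apply: dominatedM; first exact: dominatedC.
    by apply: dominatedX_exp; apply: dominatedM; [exact: dominatedC|exact: dominatedX].
  apply: (@dominated_prod _ _ (fun j => `|(x k - x j)^-1|%:P * ('X + `|x j|%:P))
    (fun j => (x k - x j)^-1%:P * ('X - (x j)%:P))) => j.
  by apply: dominatedM; [exact: dominatedC|exact: dominatedXsubC].
- rewrite /q !hornerE ?horner_exp horner_prod mulVf// expr1n mulr1.
  rewrite big1 ?mulr1// => j _; rewrite !hornerE mulVf// subr_eq0.
  by apply/eqP => /injx kj; have := ltn_ord j; rewrite -kj ltnn.
- move=> j jk; apply/eqP; rewrite /q hornerM horner_prod mulf_eq0; apply/orP; right.
  by apply/prodf_eq0; exists (Ordinal jk) => //; rewrite !hornerE /= subrr mulr0.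
- move=> r r0 rx; apply: le_trans Bm.
  rewrite /P /B !hornerE ?horner_exp horner_prod mulrAC.
  apply: ler_pM.
  + by rewrite mulr_ge0// prodr_ge0// => j _; rewrite !hornerE mulr_ge0// addr_ge0.
  + by rewrite exprn_ge0// mulr_ge0.
  + rewrite ler_wpM2l//; apply: ler_prod => j _; rewrite !hornerE.
    rewrite mulr_ge0 ?addr_ge0//= ler_wpM2l// lerD2r.
    by apply: le_trans rx; rewrite mulr2n lerDl.
  + apply: lerXn2r; rewrite ?nnegrE ?mulr_ge0 ?invr_ge0//.
    by rewrite normfV ler_pdivrMl ?normr_gt0// ler_pdivlMr// mulr_natr.
Qed.

(** The Newton series: at x_k only the terms up to the k-th one contribute,
    so its coefficients are found recursively. *)
Lemma interpolation (x c : nat -> K) : escaping x ->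
  exists F : K -> K, (forall z, differentiable F z) /\ forall k, F (x k) = c k.
Proof.
move=> xesc; have [injx xk] := xesc.
have /choice[q /= /choice[P qP]] : forall ks : nat * {poly K}, exists q P : {poly K},
    [/\ dominated P q, q.[x ks.1] = c ks.1 - ks.2.[x ks.1],
    (forall j, (j < ks.1)%N -> q.[x j] = 0)
    & forall r, 0 <= r -> r *+ 2 <= `|x ks.1| -> P.[r] <= 2^-1 ^+ ks.1].
  by move=> [k s]; apply: newton_term => //; exact: escaping_neq0.
pose S := fix S n := if n is n'.+1 then S n' + q (n', S n') else 0.
pose t n := q (n, S n); pose T n := P (n, S n).
have SE n : S n = \sum_(0 <= k < n) t k.
  by elim: n => [|n IHn]; rewrite ?big_nil// big_nat_recr//= -IHn.
have domt n : dominated (T n) (t n) by have [] := qP (n, S n).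
have Tsmall n r : 0 <= r -> r *+ 2 <= `|x n| -> (T n).[r] <= 2^-1 ^+ n.
  by have [_ _ _] := qP (n, S n); apply.
have T0 n r : 0 <= r -> 0 <= (T n).[r].
  move=> r0; rewrite -(ger0_norm r0); apply: le_trans (dominated_horner _ (domt n)).
  exact: normr_ge0.
(* the terms of index above k vanish at x k *)
have Snode n k : (k < n)%N -> (S n).[x k] = c k.
  elim: n => // n IHn; rewrite ltnS leq_eqVlt => /orP[/eqP->|kn] /=.
    by have [_ /= e _ _] := qP (n, S n); rewrite hornerD e addrC subrK.
  by have [_ _ /= e _] := qP (n, S n); rewrite hornerD IHn// e// addr0.
have Tcvg r : 0 <= r -> cvgn (series (fun n => Re (T n).[r])).
  move=> r0; pose m n := Re (T n).[r]; pose N := Num.bound (Re (r *+ 2)).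
  have mE n : (m n)%:C = (T n).[r] by rewrite RRe_real// ger0_real// T0.
  have m0 n : 0 <= m n by rewrite -ler0c mE T0.
  have mN n : (N <= n)%N -> m n <= 2^-1 ^+ n.
    move=> Nn; rewrite -lecR mE rmorphXn fmorphV rmorph_nat.
    apply: Tsmall => //; apply: le_trans (xk n).
    have r20 : 0 <= r *+ 2 by rewrite mulrn_wge0.
    rewrite -(RRe_real (ger0_real r20)) -(rmorph_nat (real_complex R)) lecR.
    apply: le_trans (ltW (archi_boundP _)) _; first by rewrite -ler0c RRe_real// ger0_real.
    by rewrite ler_nat leqW.
  (* the finitely many terms before N are absorbed in the constant of the
     geometric series *)
  pose G := 1 + \sum_(n < N) m n * 2 ^+ n.
  have S0 : 0 <= \sum_(n < N) m n * 2 ^+ n.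
    by rewrite sumr_ge0// => i _; rewrite mulr_ge0// exprn_ge0.
  apply: (@series_le_cvg _ m (geometric G 2^-1)) => // [n|n|].
  - by rewrite mulr_ge0// ?exprn_ge0 ?invr_ge0// addr_ge0.
  - have [Nn|nN] := leqP N n.
      by rewrite (le_trans (mN _ Nn))// ler_peMl ?exprn_ge0 ?invr_ge0// lerDl.
    rewrite /= exprVn ler_pdivlMr ?exprn_gt0//.
    rewrite /G (bigD1 (Ordinal nN))//= addrCA lerDl addr_ge0// sumr_ge0// => i _.
    by rewrite mulr_ge0// exprn_ge0.
  by apply: is_cvg_geometric_series; rewrite ger0_norm ?invr_ge0// invf_lt1// ltr1n.
have cvT (u : nat -> K) r : 0 <= r -> (forall n, `|u n| <= (T n).[r]) ->
    exists U : K, (series u : nat -> K) @ \oo --> U.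
  move=> r0 uT; apply: norm_series_cvg (Tcvg r r0) => n.
  by rewrite RRe_real// ger0_real// T0.
have z1 z : 0 <= `|z| + 1 :> K by rewrite addr_ge0.
have /choice[F FS] : forall z, exists U : K, (series (fun n => (t n).[z]) : nat -> K) @ \oo --> U.
  by move=> z; apply: (cvT _ `|z|) => // n; exact: dominated_horner.
have /choice[D DS] : forall z, exists U : K,
     (series (fun n => (t n)^`().[z]) : nat -> K) @ \oo --> U.
  by move=> z; apply: (cvT _ (`|z|+1)) => // n; exact: dominated_deriv.
exists F; split=> [z|k]; last first.
  apply: (cvg_unique (@norm_hausdorff _ _) (FS (x k))); apply: cvg_near_cst.
  near=> n; rewrite /series /= -(@Snode n k); last by near: n; exact: nbhs_infty_gt.
  by rewrite SE horner_sum.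
pose m n := Re (T n).[`|z| + 1].
have mE n : (m n)%:C = (T n).[`|z| + 1] by rewrite RRe_real// ger0_real// T0.
have m0 n : 0 <= m n by rewrite -ler0c mE T0.
apply: (@differentiable_quadratic _ _ _ (D z) (limn (series m))%:C) => h h1.
apply: (@norm_lim_le (fun n => series (fun n => (t n).[z + h]) n -
  series (fun n => (t n).[z]) n - series (fun n => (t n)^`().[z]) n * h)).
  apply: cvgB; first by apply: cvgB; exact: FS.
  by apply: cvgMr_tmp; exact: DS.
move=> n; rewrite /series /= mulr_suml -!sumrB.
apply: (le_trans (ler_norm_sum _ _ _)).
apply: (@le_trans _ _ (\sum_(0 <= k < n) (m k)%:C * `|h| ^+ 2)).
  by apply: ler_sum => k _; rewrite mE; exact: dominated_taylor.
rewrite -mulr_suml ler_wpM2r ?exprn_ge0// -rmorph_sum lecR.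
apply: (@nondecreasing_cvgn_le _ (series m)); last exact: Tcvg.
by apply: nondecreasing_series.
Unshelve. all: by end_near. Qed.

End Interpolation.

(** * Automorphisms and equivalence of sequences *)

Section Automorphisms.
Variable R : realType.
Local Notation K := (R[i] : numFieldType).

(** The local extensions are composed on the open set where this makes sense. *)
Lemma holomorphic_on_comp (V W Z : normedModType R[i]) (X : set V) (Y : set W)
    (f : V -> W) (g : W -> Z) :
  set_fun X Y f -> holomorphic_on X f -> holomorphic_on Y g ->
  holomorphic_on X (g \o f).
Proof.
move=> fXY hf hg p Xp; have [U [F [oU Up dF Ff]]] := hf p Xp.
have [U' [G [oU' U'p dG Gg]]] := hg (f p) (fXY _ Xp).
exists (U `&` F @^-1` U'), (G \o F); split => /=.
- rewrite openE => x [Ux U'x]; apply: filterI; first exact: open_nbhs_nbhs.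
  exact: (differentiable_continuous (dF x Ux)) (open_nbhs_nbhs (conj oU' U'x)).
- by split => //; rewrite /= Ff.
- by move=> x [Ux U'x]; apply: differentiable_comp; [exact: dF|exact: dG].
- by move=> x [Ux U'x] Xx; rewrite /= in U'x *; rewrite Ff// in U'x *; rewrite Gg//; exact: fXY.
Qed.

Lemma differentiable_holomorphic_on (V W : normedModType R[i]) (X : set V) (f : V -> W) :
  (forall x, differentiable f x) -> holomorphic_on X f.
Proof. by move=> df p _; exists setT, f; split => //; exact: openT. Qed.

Lemma is_automorphism_id (V : normedModType R[i]) (X : set V) :
  is_automorphism X (fun x => x).
Proof.
have hid : holomorphic_on X (fun x : V => x).
  by apply: differentiable_holomorphic_on => x; have [] := is_diff_id x.
by exists (fun x => x); split.
Qed.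

Lemma is_automorphism_comp (V : normedModType R[i]) (X : set V) (f g : V -> V) :
  is_automorphism X f -> is_automorphism X g -> is_automorphism X (g \o f).
Proof.
move=> [f' [fX f'X ff' f'f [hf hf']]] [g' [gX g'X gg' g'g [hg hg']]].
exists (f' \o g'); split.
- by move=> x Xx; apply: gX; exact: fX.
- by move=> x Xx; apply: f'X; exact: g'X.
- by move=> x Xx /=; rewrite gg' ?ff'//; exact: fX.
- by move=> x Xx /=; rewrite f'f ?g'g//; exact: g'X.
- by split; [exact: holomorphic_on_comp hg|exact: holomorphic_on_comp hf'].
Qed.

Section SLn.
Variable n : nat.
Local Notation M := 'M[R[i]]_n.
Local Notation MV := (M : normedModType R[i]).
Implicit Types X Y Z : nat -> M.

Definition equivalent X Y :=
  exists phi : M -> M, is_automorphism (SL R n) phi /\ forall k, phi (X k) = Y k.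

Lemma equivalent_refl X : equivalent X X.
Proof. by exists (fun x => x); split=> //; exact: is_automorphism_id. Qed.

Lemma equivalent_sym X Y : (forall k, \det (X k) = 1) ->
  equivalent X Y -> equivalent Y X.
Proof.
move=> X1 [f [[g [fS gS gf fg [hf hg]]] fX]]; exists g; split.
  by exists f; split.
by move=> k; rewrite -fX gf//; exact: X1.
Qed.

Lemma equivalent_trans X Y Z : equivalent X Y -> equivalent Y Z -> equivalent X Z.
Proof.
move=> [f [fa fX]] [g [ga gY]]; exists (g \o f); split.
  exact: is_automorphism_comp.
by move=> k; rewrite /= fX gY.
Qed.

Lemma equivalent_SL X Y : (forall k, \det (X k) = 1) -> equivalent X Y ->
  forall k, \det (Y k) = 1.
Proof. by move=> X1 [f [[g [fS _ _ _ _]] fX]] k; rewrite -fX; apply: fS; exact: X1. Qed.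

Lemma differentiable_mx (F : M -> M) (A : MV) :
  (forall i j, differentiable (fun B : M => F B i j : K) A) -> differentiable F A.
Proof.
move=> dF.
rewrite (_ : F = \sum_(i < n) \sum_(j < n) (fun B => F B i j *: delta_mx i j)); last first.
  apply/funext => B; rewrite [LHS]matrix_sum_delta fct_sumE; apply: eq_bigr => i _.
  by rewrite fct_sumE.
by apply: differentiable_sum => i; apply: differentiable_sum => j; exact: differentiableZl.
Qed.

Lemma entire_equivalent (phi psi : M -> M) X :
  (forall A, differentiable phi A) -> (forall A, differentiable psi A) ->
  (forall A, \det (phi A) = \det A) -> (forall A, \det (psi A) = \det A) ->
  cancel phi psi -> cancel psi phi -> equivalent X (fun k => phi (X k)).
Proof.
move=> dphi dpsi dphi1 dpsi1 phiK psiK; exists phi; split => //.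
exists psi; split => [A|A|A _|A _|].
- by rewrite /SL /= dphi1.
- by rewrite /SL /= dpsi1.
- exact: phiK.
- exact: psiK.
- by split; exact: differentiable_holomorphic_on.
Qed.

Lemma equivalent_tr X : equivalent X (fun k => (X k)^T).
Proof.
have dtr (A : MV) : differentiable (fun B => (B : M)^T) A.
  apply: differentiable_mx => i j.
  rewrite (_ : (fun B : M => B^T i j : K) = (fun B : M => B j i : K)).
    exact: differentiable_coord.
  by apply/funext => B; rewrite mxE.
by apply: entire_equivalent => // A; rewrite ?det_tr ?trmxK.
Qed.

Lemma trmx_seqK X : (fun k => ((X k)^T)^T) = X.
Proof. by apply/funext => k; rewrite trmxK. Qed.

Lemma equivalent_trmx X Y :
  equivalent X Y -> equivalent (fun k => (X k)^T) (fun k => (Y k)^T).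
Proof.
move=> XY; apply: equivalent_trans (equivalent_tr Y).
apply: equivalent_trans XY; have := equivalent_tr (fun k => (X k)^T).
by rewrite trmx_seqK.
Qed.

End SLn.

End Automorphisms.

Section UnipotentDet.
Variable F : comNzRingType.

(** The matrix [[1, - b], [a, 1]] has two factorizations into block triangular
    matrices; one has determinant det (1 + a b), the other one 1. *)
Lemma det_add1_mul n (a : 'cV[F]_n) (b : 'rV[F]_n) :
  b *m a = 0 -> \det (1%:M + a *m b) = 1.
Proof.
move=> ba.
have : block_mx 1%:M 0 a 1%:M *m block_mx 1%:M (- b) 0 (1%:M + a *m b)
     = block_mx 1%:M (- b) 0 1%:M *m block_mx 1%:M 0 a 1%:M :> 'M[F]_(1 + n).
  rewrite !mulmx_block !mul1mx !mulmx1 !mul0mx !mulNmx !mulmxN ba.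
  by rewrite !(addr0, add0r, oppr0) addrCA addNr addr0.
move=> /(congr1 (fun M => \det M)).
by rewrite !det_mulmx !det_lblock !det_ublock !det1 !mul1r.
Qed.

Lemma add1_mul_inv n (a : 'cV[F]_n) (b : 'rV[F]_n) :
  b *m a = 0 -> (1%:M - a *m b) *m (1%:M + a *m b) = 1%:M.
Proof.
move=> ba; rewrite mulmxDr mulmx1 mulmxBl mul1mx mulmxA -(mulmxA a) ba mulmx0 mul0mx.
by rewrite subr0 subrK.
Qed.

End UnipotentDet.

Section Shears.
Variables (R : realType) (m : nat).
Local Notation K := (R[i] : numFieldType).
Local Notation n := m.+2.
Local Notation M := 'M[R[i]]_n.
Local Notation MV := (M : normedModType R[i]).
Implicit Types X Y Z : nat -> M.

Lemma differentiable_entry (A : MV) i j : differentiable (fun B : M => B i j : K) A.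
Proof. exact: differentiable_coord. Qed.

Lemma differentiable_shear (a : K -> 'cV[R[i]]_n) (b : K -> 'rV[R[i]]_n) (A : MV) :
  (forall i z, differentiable (fun z => a z i 0 : K) z) ->
  (forall i z, differentiable (fun z => b z 0 i : K) z) ->
  differentiable (fun B : M => (1%:M + a (B 0 0) *m b (B 0 0)) *m B) A.
Proof.
move=> da db; apply: differentiable_mx => i j.
pose ai := fun B : M => a (B 0 0) i 0 : K.
pose bl l := fun B : M => b (B 0 0) 0 l : K.
pose e i j := fun B : M => B i j : K.
rewrite (_ : (fun B : M => _) = e i j + ai * \sum_l (bl l * e l j)).
  apply: differentiableD; first exact: differentiable_entry.
  have dA := differentiable_entry A 0 0.
  apply: differentiableM.
    exact: (@differentiable_comp _ MV K K (e 0 0) (fun z => a z i 0) A dA (da i _)).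
  apply: differentiable_sum => l; apply: differentiableM.
    exact: (@differentiable_comp _ MV K K (e 0 0) (fun z => b z 0 l) A dA (db l _)).
  exact: differentiable_entry.
apply/funext => B; rewrite mulmxDl mul1mx -mulmxA !mxE big_ord1 mxE.
by rewrite /e /ai /bl /GRing.add /= /GRing.mul /= fct_sumE.
Qed.

(** A shear with coefficients depending on k is induced by a single automorphism:
    entire functions a and b of the corner z interpolate the coefficients, and
    A |-> (1 + a(z) b(z)) A preserves the corner because row 0 of a(z) is zero.
    The disjoint supports S and its complement give b(z) a(z) = 0, so that
    1 + a(z) b(z) has determinant 1 and inverse 1 - a(z) b(z). *)
Lemma shear_equivalent (S : pred 'I_n) (a : nat -> 'cV[R[i]]_n)
    (b : nat -> 'rV[R[i]]_n) X :
  ~~ S 0 -> (forall k i, ~~ S i -> a k i 0 = 0) ->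
  (forall k i, S i -> b k 0 i = 0) ->
  @escaping R (fun k => X k 0 0) ->
  equivalent X (fun k => (1%:M + a k *m b k) *m X k).
Proof.
move=> S0 aS bS Xesc.
have /choice[f fP] : forall i, exists F : K -> K, (forall z, differentiable F z) /\
    forall k, F (X k 0 0) = a k i 0.
  by move=> i; exact: (@interpolation R _ (fun k => a k i 0)).
have /choice[g gP] : forall i, exists F : K -> K, (forall z, differentiable F z) /\
    forall k, F (X k 0 0) = b k 0 i.
  by move=> i; exact: (@interpolation R _ (fun k => b k 0 i)).
pose fa z : 'cV[R[i]]_n := \col_i (if S i then f i z else 0).
pose gb z : 'rV[R[i]]_n := \row_i (if S i then 0 else g i z).
have ba z : gb z *m fa z = 0.
  apply/matrixP => i j; rewrite !mxE big1// => l _; rewrite !mxE.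
  by case: ifP; rewrite ?mul0r ?mulr0.
have fa0 z : fa z 0 0 = 0 by rewrite mxE (negbTE S0).
have dfa i (z : K) : differentiable (fun z => fa z i 0 : K) z.
  rewrite (_ : (fun z => fa z i 0 : K) = if S i then f i else cst 0); last first.
    by apply/funext => w; rewrite mxE; case: ifP.
  by case: ifP => _; [exact: (fP i).1|exact: differentiable_cst].
have dgb i (z : K) : differentiable (fun z => gb z 0 i : K) z.
  rewrite (_ : (fun z => gb z 0 i : K) = if S i then cst 0 else g i); last first.
    by apply/funext => w; rewrite mxE; case: ifP.
  by case: ifP => _; [exact: differentiable_cst|exact: (gP i).1].
have dfaN i (z : K) : differentiable (fun z => (- fa z) i 0 : K) z.
  rewrite (_ : (fun z => (- fa z) i 0 : K) = - (fun z => fa z i 0 : K)).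
    exact: differentiableN.
  by apply/funext => w; rewrite mxE.
pose phi (B : M) := (1%:M + fa (B 0 0) *m gb (B 0 0)) *m B.
pose psi (B : M) := (1%:M + (- fa (B 0 0)) *m gb (B 0 0)) *m B.
have phi00 B : phi B 0 0 = B 0 0.
  by rewrite /phi mulmxDl mul1mx -mulmxA !mxE big_ord1 fa0 mul0r addr0.
have psi00 B : psi B 0 0 = B 0 0.
  by rewrite /psi mulmxDl mul1mx -mulmxA !mxE big_ord1 mxE fa0 oppr0 mul0r addr0.
rewrite (_ : (fun k => _) = fun k => phi (X k)); last first.
  apply/funext => k; congr ((_ + _ *m _) *m _).
    apply/matrixP => i j; rewrite !mxE ord1; case: ifP => Si; first by rewrite (fP i).2.
    by rewrite aS// Si.
  apply/matrixP => i j; rewrite !mxE ord1; case: ifP => Sj; last by rewrite (gP j).2.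
  by rewrite bS.
have baN z : gb z *m - fa z = 0 by rewrite mulmxN ba oppr0.
apply: (@entire_equivalent _ _ phi psi) => A.
- exact: (@differentiable_shear fa gb).
- exact: (@differentiable_shear (fun z => - fa z) gb).
- by rewrite det_mulmx det_add1_mul// mul1r.
- by rewrite det_mulmx det_add1_mul// mul1r.
- by rewrite /psi phi00 mulmxA mulNmx add1_mul_inv// mul1mx.
- by rewrite /phi psi00 mulmxA mulNmx (mulmx1C (add1_mul_inv (ba _))) mul1mx.
Qed.

Lemma unipotent_equivalent (a : 'cV[R[i]]_n) (b : 'rV[R[i]]_n) X :
  b *m a = 0 -> equivalent X (fun k => (1%:M + a *m b) *m X k).
Proof.
move=> ba; have baN : b *m - a = 0 by rewrite mulmxN ba oppr0.
apply: (@entire_equivalent _ _ (mulmx (1%:M + a *m b)) (mulmx (1%:M + - a *m b))) => A.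
- by apply: (@differentiable_shear (fun=> a) (fun=> b)) => *; exact: differentiable_cst.
- by apply: (@differentiable_shear (fun=> - a) (fun=> b)) => *; exact: differentiable_cst.
- by rewrite det_mulmx det_add1_mul// mul1r.
- by rewrite det_mulmx det_add1_mul// mul1r.
- by rewrite mulmxA mulNmx add1_mul_inv// mul1mx.
- by rewrite mulmxA mulNmx (mulmx1C (add1_mul_inv ba)) mul1mx.
Qed.

End Shears.

(** * Uniform Gaussian elimination *)

Section Elimination.
Variables (F : fieldType) (n : nat).
Implicit Types (g : 'M[F]_n).

(** The invariant of the elimination. *)
Definition unit_rows r g := forall i j : 'I_n, (i < r)%N -> g i j = (i == j)%:R.

Lemma unit_rowsS (r : 'I_n) g :
  unit_rows r g -> (forall j, g r j = (r == j)%:R) -> unit_rows r.+1 g.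
Proof.
move=> gr gri i j; rewrite ltnS leq_eqVlt => /orP[/eqP/val_inj ->//|]; exact: gr.
Qed.

Lemma mulmx_add1 g (a : 'cV[F]_n) (b : 'rV[F]_n) i j :
  (g *m (1%:M + a *m b)) i j = g i j + (g *m a) i 0 * b 0 j.
Proof. by rewrite mulmxDr mulmx1 mulmxA !mxE big_ord1 mxE. Qed.

Lemma unit_rows_mul r g (a : 'cV[F]_n) (b : 'rV[F]_n) :
  unit_rows r g -> (forall i : 'I_n, (i < r)%N -> a i 0 = 0) ->
  unit_rows r (g *m (1%:M + a *m b)).
Proof.
move=> gr ar i j ir; rewrite mulmx_add1 gr// mxE (bigD1 i)//= ar// mulr0 add0r.
rewrite big1 ?mul0r ?addr0// => l li.
by rewrite gr// eq_sym (negbTE li) mul0r.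
Qed.

(** When only the last row is free, g is triangular. *)
Lemma unit_rows_last (r : 'I_n) g : \det g = 1 -> unit_rows r g -> r.+1 = n ->
  g r r = 1.
Proof.
move=> g1 gr rn; have gtrig : is_trig_mx g.
  apply/is_trig_mxP => i j ij; rewrite gr; first by rewrite -val_eqE ltn_eqF.
  by apply: (leq_trans ij); rewrite -ltnS rn.
move: g1; rewrite det_trig// (bigD1 r)//= big1 ?mulr1// => i ir.
rewrite gr ?eqxx// ltn_neqAle ir /= -ltnS rn//.
Qed.

(** Otherwise row r would be the combination of the rows above it with
    coefficients g r j, contradicting invertibility. *)
Lemma unit_rows_pivot (r : 'I_n) g : \det g = 1 -> unit_rows r g ->
  exists2 j : 'I_n, (r <= j)%N & g r j != 0.
Proof.
move=> g1 gr; apply/not_exists2P => noj.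
have {}noj (j : 'I_n) : (r <= j)%N -> g r j = 0.
  by move=> rj; have [//|/negP] := noj j; rewrite negbK => /eqP.
pose w : 'rV[F]_n := \row_j (if j == r then 1 else if (j < r)%N then - g r j else 0).
have wg : w *m g = 0.
  apply/rowP => j; rewrite !mxE (bigD1 r)//= !mxE eqxx mul1r.
  have [jr|rj] := ltnP j r; last first.
    rewrite noj// add0r big1// => i ir; rewrite mxE (negbTE ir).
    case: ifP => [ir'|]; last by rewrite mul0r.
    by rewrite [g i j]gr// -val_eqE ltn_eqF ?mulr0//; exact: leq_trans rj.
  rewrite (bigD1 j) /=; last by rewrite -val_eqE ltn_eqF.
  rewrite mxE -val_eqE ltn_eqF//= jr [g j j]gr// eqxx mulr1 addrA subrr add0r.
  rewrite big1// => i /andP[ir ij]; rewrite mxE (negbTE ir).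
  by case: ifP => [ir'|]; rewrite ?mul0r// [g i j]gr// (negbTE ij) mulr0.
have gu : g \in unitmx by rewrite unitmxE g1 unitr1.
have : w 0 r = 0 by rewrite -(mulmxK gu w) wg mul0mx mxE.
by rewrite mxE eqxx => /eqP; rewrite oner_eq0.
Qed.

Lemma mul_delta_col g (c : F) (s i : 'I_n) :
  (g *m (c *: delta_mx s 0 : 'cV[F]_n)) i 0 = c * g i s.
Proof.
rewrite -scalemxAr mxE mxE (bigD1 s)//= mxE !eqxx mulr1 big1 ?addr0// => j js.
by rewrite mxE (negbTE js) mulr0.
Qed.

End Elimination.

Section Moves.
Variables (R : realType) (m : nat).
Local Notation K := (R[i] : numFieldType).
Local Notation n := m.+2.
Local Notation M := 'M[R[i]]_n.
Implicit Types X Y Z g : nat -> M.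

(** Left multiplication by g is realized by automorphisms, whatever the
    sequence X it is applied to.  Quantifying over X lets elementary factors be
    removed one after the other. *)
Definition moves g := forall X, (forall k, \det (X k) = 1) ->
  @escaping R (fun k => X k 0 0) -> equivalent X (fun k => g k *m X k).

Lemma moves1 g : (forall k, g k = 1%:M) -> moves g.
Proof.
move=> g1 X _ _; rewrite (_ : (fun k => _) = X); first exact: equivalent_refl.
by apply/funext => k; rewrite g1 mul1mx.
Qed.

(** Removing a factor on the right of g amounts to applying the inverse shear
    to X first; this does not change the corner. *)
Lemma moves_shearr g (S : pred 'I_n) (a : nat -> 'cV[R[i]]_n) (b : nat -> 'rV[R[i]]_n) :
  ~~ S 0 -> (forall k i, ~~ S i -> a k i 0 = 0) ->
  (forall k i, S i -> b k 0 i = 0) ->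
  moves (fun k => g k *m (1%:M + a k *m b k)) -> moves g.
Proof.
move=> S0 aS bS mg X X1 Xesc.
have ba k : b k *m a k = 0.
  apply/matrixP => i j; rewrite !mxE big1// => l _; rewrite !ord1.
  by have [Sl|Sl] := boolP (S l); [rewrite bS// mul0r|rewrite aS// mulr0].
have aNS k i : ~~ S i -> (- a k) i 0 = 0 by move=> Si; rewrite mxE aS// oppr0.
have XY := @shear_equivalent R m S (fun k => - a k) b X S0 aNS bS Xesc.
apply: (equivalent_trans XY).
rewrite (_ : (fun k => g k *m X k) = (fun k => g k *m (1%:M + a k *m b k) *m
  ((1%:M + - a k *m b k) *m X k))); last first.
  apply/funext => k; rewrite -mulmxA [(1%:M + a k *m b k) *m _]mulmxA mulNmx.
  by rewrite (mulmx1C (add1_mul_inv (ba k))) mul1mx.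
apply: mg; first by apply: equivalent_SL XY.
rewrite (_ : (fun k => _) = fun k => X k 0 0)//; apply/funext => k.
by rewrite mulmxDl mul1mx -mulmxA !mxE big_ord1 mxE aS// oppr0 mul0r addr0.
Qed.

(** Elimination by column operations on g, three shears per row: the first makes
    some entry to the right of the pivot nonzero, the second uses this entry to
    make the pivot equal to 1, the third clears the rest of the row.  For each
    row the supports of these shears are the same for all k, although the
    coefficients are not; this is why a pivot 0 is repaired without exchanging
    rows or columns. *)
Lemma moves_unit_rows d r g : (d + r.+1)%N = n -> (forall k, \det (g k) = 1) ->
  (forall k, unit_rows r.+1 (g k)) -> moves g.
Proof.
elim: d r g => [|d IHd] r g; rewrite ?add0n => drn g1 gr.
  apply: moves1 => k; apply/matrixP => i j; rewrite mxE gr// drn//.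
have rn : (r.+1 < n)%N by rewrite -drn addSn ltnS leq_addl.
pose ro : 'I_n := Ordinal rn.
have ro0 : ro != 0 by rewrite -val_eqE.
have drn' : (d + r.+2)%N = n by rewrite addnS -addSn.
have det_shear h (S : pred 'I_n) (a : nat -> 'cV[R[i]]_n) (b : nat -> 'rV[R[i]]_n) :
    (forall k, \det (h k) = 1) -> (forall k i, ~~ S i -> a k i 0 = 0) ->
    (forall k i, S i -> b k 0 i = 0) ->
    forall k, \det (h k *m (1%:M + a k *m b k)) = 1.
  move=> h1 aS bS k; rewrite det_mulmx h1 mul1r det_add1_mul//.
  apply/matrixP => i j; rewrite !mxE big1// => l _; rewrite !ord1.
  by have [Sl|Sl] := boolP (S l); [rewrite bS// mul0r|rewrite aS// mulr0].
(* third shear: row r is cleared by multiples of its pivot *)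
have pivot1 h : (forall k, \det (h k) = 1) -> (forall k, unit_rows r.+1 (h k)) ->
    (forall k, h k ro ro = 1) -> moves h.
  move=> h1 hr hro.
  pose a (k : nat) : 'cV[R[i]]_n := (-1) *: delta_mx ro 0.
  pose b (k : nat) : 'rV[R[i]]_n := \row_j (if j == ro then 0 else h k ro j).
  have aS k i : i != ro -> a k i 0 = 0 by move=> iro; rewrite !mxE (negbTE iro) mulr0.
  have bS k i : i == ro -> b k 0 i = 0 by move=> iro; rewrite mxE iro.
  apply: (@moves_shearr h (pred1 ro) a b); rewrite //= 1?eq_sym//.
  apply: (IHd r.+1) => //; first exact: (det_shear _ (pred1 ro)).
  move=> k; apply: (@unit_rowsS _ _ ro).
    by apply: unit_rows_mul => // i ir; rewrite aS// -val_eqE ltn_eqF.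
  move=> j; rewrite mulmx_add1 mul_delta_col hro mulr1 mxE [ro == j]eq_sym.
  case: eqP => [->|_]; first by rewrite mulr0 addr0 hro.
  by rewrite mulN1r subrr.
have [rl|rl] := eqVneq r.+2 n.
  by apply: pivot1 => // k; apply: unit_rows_last.
have {rl} rsn : (r.+2 < n)%N by rewrite ltn_neqAle rl.
pose rs : 'I_n := Ordinal rsn.
(* second shear: the entry at j k, to the right of the pivot, corrects it *)
have pivot2 h : (forall k, \det (h k) = 1) -> (forall k, unit_rows r.+1 (h k)) ->
    (forall k, exists j : 'I_n, (ro < j)%N /\ h k ro j != 0) -> moves h.
  move=> h1 hr /choice[j hj].
  have jr k : (ro < j k)%N by have [] := hj k.
  have hj0 k : h k ro (j k) != 0 by have [] := hj k.
  pose a (k : nat) : 'cV[R[i]]_n := ((1 - h k ro ro) / h k ro (j k)) *: delta_mx (j k) 0.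
  pose b (k : nat) : 'rV[R[i]]_n := delta_mx 0 ro.
  pose S : pred 'I_n := fun i => (ro < i)%N.
  have aS k i : ~~ S i -> a k i 0 = 0.
    by rewrite /S => Si; rewrite !mxE; case: eqP => [iE|]; rewrite ?mulr0//; rewrite iE jr in Si.
  have bS k i : S i -> b k 0 i = 0.
    by rewrite /S => Si; rewrite mxE eqxx -val_eqE gtn_eqF.
  apply: (@moves_shearr h S a b) => //.
  apply: pivot1; first exact: (det_shear _ S).
    by move=> k; apply: unit_rows_mul => // i ir; apply: aS; rewrite /S -leqNgt ltnW.
  move=> k; rewrite mulmx_add1 mul_delta_col divfK// mxE !eqxx mulr1.
  by rewrite addrC subrK.
(* first shear: the pivot is copied to its right when nothing else is there *)
pose z k := [forall j : 'I_n, (ro < j)%N ==> (g k ro j == 0)].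
pose a (k : nat) : 'cV[R[i]]_n := (z k)%:R *: delta_mx ro 0.
pose b (k : nat) : 'rV[R[i]]_n := delta_mx 0 rs.
have rsro : rs != ro by rewrite -val_eqE /= gtn_eqF.
have aS k i : i != ro -> a k i 0 = 0 by move=> iro; rewrite !mxE (negbTE iro) mulr0.
have bS k i : i == ro -> b k 0 i = 0.
  by move=> /eqP ->; rewrite mxE eqxx eq_sym (negbTE rsro).
apply: (@moves_shearr g (pred1 ro) a b); rewrite //= 1?eq_sym//.
apply: pivot2; first exact: (det_shear _ (pred1 ro)).
  by move=> k; apply: unit_rows_mul => // i ir; rewrite aS// -val_eqE ltn_eqF.
move=> k; have [zk|] := boolP (z k).
  exists rs; split; first by [].
  have /eqP grs : g k ro rs == 0 by have /forallP/(_ rs)/implyP := zk; apply.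
  rewrite mulmx_add1 mul_delta_col grs add0r zk mul1r mxE !eqxx mulr1.
  have [j rj gj] := unit_rows_pivot (g1 k) (gr k : unit_rows ro (g k)).
  move: rj gj; rewrite leq_eqVlt => /orP[/eqP/val_inj <-//|rj].
  by have /forallP/(_ j)/implyP/(_ rj)/eqP -> := zk; rewrite eqxx.
rewrite negb_forall => /existsP[j]; rewrite negb_imply => /andP[rj gj].
exists j; split => //; rewrite mulmx_add1 mul_delta_col.
rewrite (_ : z k = false) ?mul0r ?addr0//; apply/negbTE; rewrite negb_forall.
by apply/existsP; exists j; rewrite negb_imply rj.
Qed.

End Moves.

(** * Sequences with an escaping corner *)

Section Corner.
Variables (R : realType) (m : nat).
Local Notation K := (R[i] : numFieldType).
Local Notation n := m.+2.
Local Notation M := 'M[R[i]]_n.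
Implicit Types X Y Z g : nat -> M.

Lemma shear_corner (X : M) (a : 'cV[R[i]]_n) i :
  ((1%:M + a *m delta_mx 0 0 : M) *m X) i 0 = X i 0 + a i 0 * X 0 0.
Proof. by rewrite mulmxDl mul1mx -mulmxA -rowE !mxE big_ord1 mxE. Qed.

(** The column 0 of X k, whose corner is nonzero, is changed into any column with
    the same corner by adding multiples of row 0 to the other rows. *)
Lemma prescribe_column X (c : nat -> 'cV[R[i]]_n) :
  (forall k, c k 0 0 = X k 0 0) -> @escaping R (fun k => X k 0 0) ->
  exists Y, equivalent X Y /\ forall k, col 0 (Y k) = c k.
Proof.
move=> c0 Xesc.
pose a k : 'cV[R[i]]_n := \col_i (if i == 0 then 0 else (c k i 0 - X k i 0) / X k 0 0).
exists (fun k => (1%:M + a k *m delta_mx 0 0) *m X k); split.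
  apply: (@shear_equivalent R m (predC1 0) a (fun=> delta_mx 0 0)) => //= k i.
    by rewrite negbK => /eqP->; rewrite mxE eqxx.
  by move=> i0; rewrite mxE (negbTE i0).
move=> k; apply/colP => i; rewrite mxE shear_corner mxE.
case: eqP => [->|_]; first by rewrite mul0r addr0 c0.
by rewrite divfK ?(escaping_neq0 k Xesc)// addrC subrK.
Qed.

Lemma normal_row X : @escaping R (fun k => X k 0 0) ->
  exists Y, equivalent X Y /\ forall k, row 0 (Y k) = X k 0 0 *: delta_mx 0 0.
Proof.
move=> Xesc.
have [||Y [XY Yc]] := @prescribe_column (fun k => (X k)^T)
    (fun k => X k 0 0 *: delta_mx 0 0).
- by move=> k; rewrite !mxE eqxx mulr1.
- by rewrite (_ : (fun k => _) = (fun k => X k 0 0))//; apply/funext => k; rewrite mxE.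
exists (fun k => (Y k)^T); split.
  have := equivalent_trmx XY.
  by rewrite trmx_seqK.
by move=> k; rewrite -tr_col Yc linearZ /= trmx_delta.
Qed.

(** After column operations both sequences have the same row 0, namely a multiple
    of the first basis vector.  The quotient of the two sequences then has row 0
    equal to that of the identity, so that the elimination applies to it. *)
Lemma corner_determines X Y : (forall k, \det (X k) = 1) -> (forall k, \det (Y k) = 1) ->
  @escaping R (fun k => X k 0 0) -> (forall k, X k 0 0 = Y k 0 0) -> equivalent X Y.
Proof.
move=> X1 Y1 Xesc XY.
have XY' : (fun k => X k 0 0) = (fun k => Y k 0 0) by apply/funext.
have [X' [XX' Xr]] := normal_row Xesc.
have [Y' [YY' Yr]] : exists Y', equivalent Y Y' /\ forall k, row 0 (Y' k) = X k 0 0 *: delta_mx 0 0.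
  have [|Y' [YY' Yr]] := @normal_row Y; first by rewrite -XY'.
  by exists Y'; split => // k; rewrite Yr XY.
have X'1 := equivalent_SL X1 XX'; have Y'1 := equivalent_SL Y1 YY'.
have X'u k : X' k \in unitmx by rewrite unitmxE X'1 unitr1.
apply: (equivalent_trans XX'); apply: (equivalent_trans _ (equivalent_sym Y1 YY')).
rewrite (_ : Y' = fun k => (Y' k *m invmx (X' k)) *m X' k); last first.
  by apply/funext => k; rewrite mulmxKV.
apply: (@moves_unit_rows R m m.+1 0) => //.
- by rewrite addn1.
- by move=> k; rewrite det_mulmx det_inv X'1 Y'1 invr1 mulr1.
- move=> k i j; rewrite ltnS leqn0 => /eqP i0.
  have -> : i = 0 by apply: val_inj.
  have := row_mul 0 (Y' k) (invmx (X' k)).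
  rewrite Yr -Xr -row_mul mulmxV// => /rowP/(_ j); rewrite !mxE => ->.
  by [].
rewrite (_ : (fun k => _) = fun k => X k 0 0)//; apply/funext => k.
by have /rowP/(_ 0) := Xr k; rewrite !mxE eqxx mulr1.
Qed.

(** Prescribing the entries (1, 0) as y - x and 0 makes the corners of both
    sequences equal to y after row 1 is added to row 0. *)
Lemma corner_equivalent X Y : (forall k, \det (X k) = 1) -> (forall k, \det (Y k) = 1) ->
  @escaping R (fun k => X k 0 0) -> @escaping R (fun k => Y k 0 0) -> equivalent X Y.
Proof.
move=> X1 Y1 Xesc Yesc.
pose c (x y : K) : 'cV[R[i]]_n := x *: delta_mx 0 0 + y *: delta_mx 1 0.
have c0 x y : c x y 0 0 = x by rewrite !mxE eqxx mulr1 mulr0 addr0.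
have c1 x y : c x y 1 0 = y by rewrite !mxE eqxx mulr1 mulr0 add0r.
have [|X' [XX' X'c]] := @prescribe_column X
    (fun k => c (X k 0 0) (Y k 0 0 - X k 0 0)) _ Xesc; first by move=> k.
have [|Y' [YY' Y'c]] := @prescribe_column Y (fun k => c (Y k 0 0) 0) _ Yesc; first by move=> k.
have X'1 := equivalent_SL X1 XX'; have Y'1 := equivalent_SL Y1 YY'.
pose g : M := 1%:M + (delta_mx 0 0 : 'cV[R[i]]_n) *m (delta_mx 0 1 : 'rV[R[i]]_n).
have d0 : (delta_mx 0 1 : 'rV[R[i]]_n) *m (delta_mx 0 0 : 'cV[R[i]]_n) = 0.
  by rewrite mul_delta_mx_0.
have gE (Z : M) : (g *m Z) 0 0 = Z 0 0 + Z 1 0.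
  by rewrite mulmxDl mul1mx -mulmxA -rowE !mxE big_ord1 !mxE eqxx mul1r.
have gX := unipotent_equivalent X' d0; have gY := unipotent_equivalent Y' d0.
have cE (Z : M) i : Z i 0 = col 0 Z i 0 by rewrite mxE.
have corner k : (g *m X' k) 0 0 = Y k 0 0 /\ (g *m Y' k) 0 0 = Y k 0 0.
  by rewrite !gE ![X' k _ _]cE ![Y' k _ _]cE X'c Y'c !c0 !c1 addr0 addrC subrK.
apply: (equivalent_trans (equivalent_trans XX' gX)).
apply: (equivalent_trans _ (equivalent_sym Y1 (equivalent_trans YY' gY))).
apply: corner_determines.
- exact: equivalent_SL gX.
- exact: equivalent_SL gY.
- rewrite (_ : (fun k => _) = fun k => Y k 0 0)//; apply/funext => k.
  by have [] := corner k.
by move=> k; have [-> ->] := corner k.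
Qed.

End Corner.

(** * Generic linear functionals *)

Section Generic.
Variables (R : realType).
Local Notation K := (R[i] : numFieldType).

Definition pairing d (u : 'I_d -> R) (y : 'I_d -> R[i]) : K := \sum_j (u j)%:C * y j.

(** One step of a construction by nested cubes.  The functionals u and
    u + (r / 2) e_i, with |y i| maximal, differ by (r / 2) |y i| at y, so one of them
    has modulus at least (r / 4) |y i|.  In dimension d, raising
    its coordinates by at most r / (8 d) loses at most half of that. *)
Lemma pairing_step N (u : 'I_N.+1 -> R) (r : R) (y : 'I_N.+1 -> R[i]) : 0 < r ->
  exists v, (forall j, u j <= v j <= u j + r / 2) /\
   forall w, (forall j, v j <= w j <= v j + r / (8 * N.+1%:R)) ->
     forall i, (r / 8)%:C * `|y i| <= `|pairing w y|.
Proof.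
move=> r0.
have [i0 imax] : exists i0, forall i, `|y i| <= `|y i0|.
  pose f i := Re `|y i|; exists [arg max_(i > 0 | true) f i]%O => i.
  case: arg_maxP => // i0 _ /(_ i isT) /= fi.
  by rewrite -(RRe_real (normr_real (y i))) -(RRe_real (normr_real (y i0))) lecR.
pose v1 j : R := u j + (if j == i0 then r / 2 else 0).
have v1E : pairing v1 y = pairing u y + (r / 2)%:C * y i0.
  rewrite /pairing (bigD1 i0)//= [in RHS](bigD1 i0)//= /v1 eqxx raddfD mulrDl addrAC.
  by congr (_ + _ + _); apply: eq_bigr => j /negbTE ->; rewrite addr0.
have [v [uv vi0]] : exists v, (forall j, u j <= v j <= u j + r / 2) /\
    (r / 4)%:C * `|y i0| <= `|pairing v y|.
  have r20 : 0 <= r / 2 by rewrite divr_ge0// ltW.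
  have [ule|] := boolP ((r / 4)%:C * `|y i0| <= `|pairing u y|).
    by exists u; split => // j; rewrite lexx lerDl.
  rewrite -real_ltNge ?realM ?normr_real// => [ult|]; last first.
    by rewrite ger0_real// ler0c divr_ge0// ltW.
  exists v1; split=> [j|]; first by rewrite /v1; case: eqP; rewrite ?addr0 ?lexx lerDl !r20.
  have : `|(r / 2)%:C * y i0| <= `|pairing v1 y| + `|pairing u y|.
    by rewrite -[_ * _](addKr (pairing u y)) -v1E addrC; apply: ler_normB.
  rewrite normrM ger0_norm ?ler0c// (_ : (r / 2)%:C = (r / 4)%:C + (r / 4)%:C); last first.
    by rewrite -raddfD -mulrDr; congr (_ * _)%:C; field.
  rewrite mulrDl => le1; have := le_trans le1 (lerD (lexx _) (ltW ult)).
  by rewrite lerD2r.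
exists v; split => // w vw i.
have wv : `|pairing w y - pairing v y| <= (r / 8)%:C * `|y i0|.
  rewrite /pairing -sumrB; apply: (le_trans (ler_norm_sum _ _ _)).
  apply: (@le_trans _ _ (\sum_(j < N.+1) (r / (8 * N.+1%:R))%:C * `|y i0|)).
    apply: ler_sum => j _; rewrite -mulrBl -raddfB normrM ler_pM//.
    have /andP[vw1 vw2] := vw j.
    by rewrite ger0_norm ?ler0c ?subr_ge0// lecR lerBlDl.
  rewrite sumr_const card_ord -[leLHS]mulr_natl mulrA -(rmorph_nat (real_complex R)) -rmorphM.
  rewrite (_ : N.+1%:R * (r / (8 * N.+1%:R)) = r / 8)//.
  by rewrite invfM mulrCA; congr (_ * _); rewrite mulrCA divff ?pnatr_eq0// mulr1.
apply: (@le_trans _ _ ((r / 8)%:C * `|y i0|)).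
  by rewrite ler_wpM2l// ler0c divr_ge0// ltW.
rewrite -(lerD2r (`|pairing w y - pairing v y|)).
apply: (@le_trans _ _ ((r / 4)%:C * `|y i0|)).
  rewrite (_ : (r / 4)%:C = (r / 8)%:C + (r / 8)%:C) ?mulrDl ?lerD2l//.
  by rewrite -raddfD -mulrDr; congr (_ * _)%:C; field.
apply: (le_trans vi0); rewrite -[X in `|X| <= _](subKr (pairing w y)).
exact: ler_normB.
Qed.

(** The cubes of [pairing_step] shrink at a rate independent of the vectors y t, so
    the constants delta are chosen before y.  The common point w of the cubes
    satisfies all the inequalities, and is then divided by its coordinate 0,
    which lies between 1 and 2. *)
Lemma generic_functional_nat N : exists delta : nat -> R, (forall t, 0 < delta t) /\
  forall y : nat -> 'I_N.+1 -> R[i], exists u : 'I_N.+1 -> R,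
    u 0 = 1 /\ forall t i, (delta t)%:C * `|y t i| <= `|pairing u (y t)|.
Proof.
pose rho : R := (8 * N.+1%:R)^-1.
have rho0 : 0 < rho by rewrite invr_gt0 mulr_gt0.
have rho2 : rho <= 2^-1.
  rewrite lef_pV2 ?posrE ?mulr_gt0// -natrM ler_nat; lia.
pose r t := rho ^+ t.
have r0 t : 0 < r t by rewrite exprn_gt0.
exists (fun t => r t / 16); split=> [t|y]; first by rewrite divr_gt0.
have /choice[f fP] : forall ut : ('I_N.+1 -> R) * nat, exists v,
    (forall j, ut.1 j <= v j <= ut.1 j + r ut.2 / 2) /\
   forall w, (forall j, v j <= w j <= v j + r ut.2 / (8 * N.+1%:R)) ->
     forall i, (r ut.2 / 8)%:C * `|y ut.2 i| <= `|pairing w (y ut.2)|.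
  by move=> [u t]; exact: pairing_step.
pose u := fix u t := if t is t'.+1 then f (u t', t') else (fun=> 1) : 'I_N.+1 -> R.
have uS t j : u t j <= u t.+1 j <= u t j + r t / 2 by have [+ _] := fP (u t, t); apply.
have rS t : r t.+1 = r t / (8 * N.+1%:R) by rewrite /r exprSr.
have rS2 t : r t.+1 <= r t / 2 by rewrite /r exprSr ler_wpM2l// ltW// r0.
have unest s t j : u t j <= u (t + s)%N j /\ u (t + s)%N j + r (t + s)%N <= u t j + r t.
  elim: s => [|s [IH1 IH2]]; first by rewrite addn0.
  rewrite addnS; have /andP[h1 h2] := uS (t + s)%N j; split; first exact: le_trans h1.
  apply: le_trans IH2; apply: le_trans (lerD h2 (rS2 _)) _.
  by rewrite -addrA -splitr.
have und j : nondecreasing_seq (fun t => u t j).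
  by move=> s t st; rewrite -(subnKC st); have [] := unest (t - s)%N s j.
have ubd s t j : u s j <= u t j + r t.
  have [st|ts] := leqP s t; first by apply: le_trans (und j _ _ st) _; rewrite lerDl ltW.
  rewrite -(subnKC (ltnW ts)); have [_] := unest (s - t)%N t j.
  by apply: le_trans; rewrite lerDl ltW.
pose w j := limn (fun t => u t j).
have ucv j : cvgn (fun t => u t j).
  apply: nondecreasing_is_cvgn; first exact: und.
  by exists (u 0%N j + r 0%N) => _ [s _ <-].
have uw t j : u t j <= w j by apply: nondecreasing_cvgn_le => //; exact: und.
have wu t j : w j <= u t j + r t by apply: limr_le => //; near=> s; exact: ubd.
have pw t i : (r t / 8)%:C * `|y t i| <= `|pairing w (y t)|.
  have [_ /(_ w)] := fP (u t, t); apply => j /=.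
  by rewrite -rS -[f (u t, t) j]/(u t.+1 j) uw wu.
have w1 : 1 <= w 0 by exact: (uw 0%N 0).
have w2 : w 0 <= 2 by apply: le_trans (wu 0%N 0) _; rewrite /r expr0.
have w0 : 0 < w 0 by apply: lt_le_trans w1.
exists (fun j => w j / w 0); split=> [|t i]; first by rewrite divff// gt_eqF.
have -> : pairing (fun j => w j / w 0) (y t) = (w 0)^-1%:C * pairing w (y t).
  rewrite /pairing mulr_sumr; apply: eq_bigr => j _.
  by rewrite rmorphM /= mulrAC mulrC.
have w0V : 0 <= (w 0)^-1 by rewrite invr_ge0 ltW.
rewrite normrM [`|(w 0)^-1%:C|]ger0_norm ?ler0c//.
rewrite (_ : (r t / 16)%:C * `|y t i| = 2^-1%:C * ((r t / 8)%:C * `|y t i|)); last first.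
  rewrite (_ : r t / 16 = 2^-1 * (r t / 8)); last by field.
  by rewrite rmorphM mulrA.
apply: ler_pM => //.
- by rewrite ler0c invr_ge0.
- by rewrite mulr_ge0// ler0c divr_ge0// ltW.
- by rewrite lecR lef_pV2// posrE.
Unshelve. all: by end_near. Qed.

Lemma generic_functional (T : countType) N : exists delta : T -> R, (forall t, 0 < delta t) /\
  forall y : T -> 'I_N.+1 -> R[i], exists u : 'I_N.+1 -> R,
    u 0 = 1 /\ forall t i, (delta t)%:C * `|y t i| <= `|pairing u (y t)|.
Proof.
have [delta [d0 dP]] := generic_functional_nat N.
exists (delta \o pickle); split => [t|y]; first exact: d0.
have [u [u0 uP]] := dP (fun k => if unpickle k is Some t then y t else fun=> 0).
by exists u; split => // t i; have := uP (pickle t) i; rewrite pickleK.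
Qed.

End Generic.

(** * Generic corners and the norm exhaustion *)

Section GenericCorner.
Variables (R : realType) (m : nat).
Local Notation K := (R[i] : numFieldType).
Local Notation n := m.+2.
Local Notation M := 'M[R[i]]_n.
Implicit Types X Y Z : nat -> M.

(** As u 0 = 1, replacing row 0 by the combination u of the rows is multiplication
    by the unipotent matrix 1 + e_0 (u - e_0). *)
Lemma mix_rows X (u : 'I_n -> R) : u 0 = 1 ->
  exists Y, equivalent X Y /\ forall k j, Y k 0 j = pairing u (fun i => X k i j).
Proof.
move=> u0.
pose b : 'rV[R[i]]_n := \row_i (u i)%:C - delta_mx 0 0.
have b0 : b *m (delta_mx 0 0 : 'cV[R[i]]_n) = 0.
  by rewrite -colE; apply/matrixP => i j; rewrite !mxE ord1 u0 eqxx subrr.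
exists (fun k => (1%:M + delta_mx 0 0 *m b) *m X k); split.
  exact: unipotent_equivalent.
move=> k j; rewrite mulmxDl mul1mx -mulmxA mulmxBl -rowE mulmxBr.
rewrite !mxE !big_ord1 !mxE eqxx !mul1r addrCA subrr addr0.
by apply: eq_bigr => i _; rewrite mxE.
Qed.

Lemma mix_cols X (v : 'I_n -> R) : v 0 = 1 ->
  exists Y, equivalent X Y /\ forall k i, Y k i 0 = pairing v (X k i).
Proof.
move=> v0; have [Y [XY YE]] := mix_rows (fun k => (X k)^T) v0.
exists (fun k => (Y k)^T); split.
  have := equivalent_trmx XY.
  by rewrite trmx_seqK.
move=> k i; rewrite mxE YE; congr pairing; apply/funext => j; rewrite mxE//.
Qed.

Lemma pairingB d (u : 'I_d -> R) (y z : 'I_d -> R[i]) :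
  pairing u (fun i => y i - z i) = pairing u y - pairing u z.
Proof. by rewrite /pairing -sumrB; apply: eq_bigr => i _; rewrite mulrBr. Qed.

(** The functional v is applied to rows of differences of the matrices, then u to
    the resulting column vectors.  Growth and distinctness of the numbers
    u A(k) v are both lower bounds for differences B k - B l, where the
    sequence B is A preceded by the zero matrix. *)
Lemma generic_corner : exists Z : nat -> R, (forall k, 0 <= Z k) /\
  forall A : nat -> M, (forall k, \det (A k) = 1) -> injective A ->
    (forall k, exists i j, (Z k)%:C <= `|A k i j|) ->
  exists Y, equivalent A Y /\ @escaping R (fun k => Y k 0 0).
Proof.
have [dv [dv0 dvP]] := generic_functional R (nat * nat * 'I_n)%type m.+1.
have [du [du0 duP]] := generic_functional R (nat * nat)%type m.+1.
pose z k i : R := k.+1%:R / (dv (k.+1, 0%N, i) * du (k.+1, 0%N)).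
have z0 k i : 0 <= z k i by rewrite divr_ge0// mulr_ge0// ltW.
exists (fun k => \sum_i z k i); split=> [k|A A1 injA Abig]; first exact: sumr_ge0.
pose B k := if k is k'.+1 then A k' else 0.
have [v [v1 vP]] := dvP (fun t j => B t.1.1 t.2 j - B t.1.2 t.2 j).
have [u [u1 uP]] := duP (fun t i => pairing v (B t.1 i) - pairing v (B t.2 i)).
have [A' [AA' A'E]] := mix_cols A v1.
have [Y [A'Y YE]] := mix_rows A' u1.
exists Y; split; first exact: equivalent_trans A'Y.
pose x k := pairing u (fun i => pairing v (B k i)).
have YxE k : Y k 0 0 = x k.+1.
  by rewrite YE; congr pairing; apply/funext => i; rewrite A'E.
have main k l i j : (du (k, l) * dv (k, l, i))%:C * `|B k i j - B l i j| <= `|x k - x l|.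
  rewrite /x -pairingB; apply: le_trans (uP (k, l) i).
  rewrite rmorphM -mulrA; apply: ler_wpM2l; first by rewrite ler0c ltW.
  by rewrite /= -pairingB; exact: (vP (k, l, i) j).
split=> [k l kl|k].
  apply: injA; apply/matrixP => i j; apply/eqP; rewrite -subr_eq0 -normr_le0.
  have := main k.+1 l.+1 i j; rewrite -!YxE kl subrr normr0 pmulr_rle0//.
  by rewrite ltcR mulr_gt0.
have [i [j Aij]] := Abig k.
have := main k.+1 0%N i j; rewrite YxE /= mxE subr0.
have -> : x 0%N = 0.
  rewrite /x /pairing big1// => l _; rewrite big1 ?mulr0// => l' _; by rewrite mxE mulr0.
rewrite subr0; apply: le_trans.
have dd0 : 0 < du (k.+1, 0%N) * dv (k.+1, 0%N, i) by rewrite mulr_gt0.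
rewrite mulrC -ler_pdivrMr ?ltcR//; apply: le_trans Aij.
rewrite (bigD1 i)//= -(rmorph_nat (real_complex R)) -fmorph_div lecR.
rewrite [du _ * _]mulrC -/(z k i) lerDl.
by apply: sumr_ge0.
Qed.

End GenericCorner.

Lemma det_continuous (K : numFieldType) n : continuous (fun A : 'M[K]_n => \det A).
Proof.
have addc : continuous (fun z : K * K => z.1 + z.2) by exact: add_continuous.
apply: (@continuous_big K _ _ _ _ addc 'M[K]_n _
  (fun (s : 'S_n) (A : 'M[K]_n) => (-1) ^+ s * \prod_i A i (s i))) => s _ A.
apply: (@cvgM K _ (nbhs A)); first exact: (@cvg_cst K).
move: A; apply: (@continuous_big K _ _ _ _ (@mul_continuous K) 'M[K]_n _
  (fun (i : 'I_n) (A : 'M[K]_n) => A i (s i))) => i _.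
exact: coord_continuous.
Qed.

Section Exhaustion.
Variables (R : realType) (n : nat).
Local Notation K := (R[i] : numFieldType).
Local Notation M := 'M[R[i]]_n.
Local Notation MV := (M : normedModType R[i]).

Lemma Re_continuous : continuous (fun z : K => Re z).
Proof.
move=> z; have FF := nbhs_filter (z : K); apply/(@cvgrPdist_le _ _ _ _ FF) => e e0.
have e0' : 0 < e%:C by rewrite ltcR.
apply: filterS (nbhsx_ballx (z : K) _ e0') => w; rewrite -ball_normE => /ltW zw.
by rewrite -raddfB; exact: norm_Re_le.
Qed.

Lemma complex_box_compact (c : R) :
  compact [set z : K | `|Re z| <= c /\ `|Im z| <= c].
Proof.
pose f (p : R * R) : K := p.1 +i* p.2.
rewrite (_ : mkset _ = f @` (`[- c, c]%classic `*` `[- c, c]%classic)); last first.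
  apply/seteqP; split => [z [zr zi]|_ [[a b] [/= + +] <-]] /=.
    exists (Re z, Im z); last by rewrite /f; case: z zr zi.
    by split; rewrite /= in_itv /= -ler_norml.
  by rewrite !in_itv /= -!ler_norml.
apply: continuous_compact; last first.
  by apply: compact_setX; exact: segment_compact.
apply: continuous_subspaceT => p; apply/cvgrPdist_le => e e0.
have er : e = (Re e)%:C by rewrite RRe_real// gtr0_real.
have e20 : 0 < Re e / 2 by rewrite divr_gt0// -ltcR -er.
have c1 : (fun q : R * R => q.1) @ p --> p.1 by exact: cvg_fst.
have c2 : (fun q : R * R => q.2) @ p --> p.2 by exact: cvg_snd.
near=> q; apply: (le_trans (norm_ReIm_le _)); rewrite er lecR (splitr (Re e)) !raddfB lerD//=.
  by near: q; move/cvgrPdist_le : c1; apply.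
by near: q; move/cvgrPdist_le : c2; apply.
Unshelve. all: by end_near. Qed.

Lemma matrix_box_compact (B : set K) : compact B ->
  compact [set A : MV | forall i j, B (A i j)].
Proof.
pose RV := 'rV[R[i]]_(n * n) : normedModType R[i].
move=> Bc; pose f (v : 'rV[R[i]]_(n * n)) : MV := vec_mx v.
rewrite (_ : mkset _ = f @` [set v : 'rV[R[i]]_(n * n) | forall i, B (v 0 i)]); last first.
  apply/seteqP; split => [A AB|_ [v vB <-] i j]; last by rewrite /f mxE; exact: vB.
  exists (mxvec A); last by rewrite /f mxvecK.
  by move=> i /=; case/mxvec_indexP: i => i j; rewrite mxvecE; exact: AB.
apply: (@continuous_compact RV MV f); last exact: (@rV_compact K _ (fun=> B)).
apply: continuous_subspaceT => v s /nbhs_ballP[e e0 es].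
apply/nbhs_ballP; exists e => // w [e1 vw]; apply: es; split => // i j.
by rewrite /f !mxE; exact: vw.
Qed.

Lemma SL_closed : closed (SL R n : set MV).
Proof.
rewrite (_ : SL R n = (fun A : MV => \det A : K) @^-1` [set x | x = 1])//.
apply: (@preimage_closed MV K) => [A _|].
  exact: (@det_continuous K).
exact/(@accessible_closed_set1 K)/hausdorff_accessible/norm_hausdorff.
Qed.

(** Sublevel sets are closed and contained in a product of compact boxes. *)
Lemma norm_exhaustion : @is_exhaustion R MV (SL R n) (fun A : MV => Re `|A|).
Proof.
have cont : continuous (fun A : MV => Re `|A|).
  move=> A; apply: (@continuous_comp _ K); first exact: norm_continuous.
  exact: Re_continuous.
split; first exact: continuous_subspaceT.
  by move=> A _; rewrite -ler0c RRe_real// normr_real.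
move=> c; apply: (@subclosed_compact _ _ [set A : MV | forall i j,
    [set z : K | `|Re z| <= c /\ `|Im z| <= c] (A i j)]).
- apply: closedI; first exact: SL_closed.
  apply: (@preimage_closed MV R (fun A : MV => Re `|A|) [set x | x <= c]) => [A _|].
    exact: cont.
  exact: closed_le.
- by apply: matrix_box_compact; exact: complex_box_compact.
move=> A [_ Ac] i j.
have : `|A i j| <= c%:C.
  rewrite -(RRe_real (normr_real A)) in Ac *.
  apply: (@le_trans _ _ `|A|); last by rewrite -(RRe_real (normr_real A)) lecR.
  by rewrite [leRHS]mx_normE -[leLHS]nngE num_le; exact: (le_bigmax _ _ (i, j)).
by split; [exact: norm_Re_le|exact: norm_Im_le].
Qed.

End Exhaustion.

(** * Tame sequences *)

Section Tame.
Variables (R : realType) (m : nat).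
Local Notation n := m.+2.
Local Notation M := 'M[R[i]]_n.
Local Notation MV := (M : normedModType R[i]).

(** The growth required by [generic_corner] does not depend on the sequence, so it
    can serve as zeta before the automorphism phi is known. *)
Lemma tame_corner (A : nat -> M) : injective A -> @tame R MV (SL R n) (range A) ->
  (forall k, \det (A k) = 1) /\
  exists Y, equivalent A Y /\ @escaping R (fun k => Y k 0 0).
Proof.
move=> injA [_ [AS _] Atame].
have A1 k : \det (A k) = 1 by apply: AS; exists k.
split => //; have [Z [Z0 ZP]] := generic_corner R m.
have [phi [phia phiZ]] := Atame _ (fun x => Z (xget 0%N [set k | A k = x]))
  (@norm_exhaustion R n) (fun x _ => Z0 _).
have AA' : equivalent A (fun k => phi (A k)) by exists phi.
have A'1 := equivalent_SL A1 AA'.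
have injA' : injective (fun k => phi (A k)).
  move=> k l; have [psi [_ _ psiK _ _]] := phia.
  by move=> /(congr1 psi); rewrite (psiK _ (A1 k)) (psiK _ (A1 l)); exact: injA.
have [|Y [A'Y Yesc]] := ZP _ A'1 injA'; last first.
  by exists Y; split => //; exact: equivalent_trans A'Y.
move=> k; have := phiZ (A k); rewrite (_ : xget _ _ = k); last first.
  by apply: injA; apply: (@xgetPex _ 0%N [set l | A l = A k]); exists k.
move=> /(_ (ex_intro2 _ _ k I erefl)) Zk.
have : mx_norm (phi (A k)) != 0.
  apply/eqP => /mx_norm_eq0 A0.
  by have /eqP := A'1 k; rewrite A0 det0 eq_sym oner_eq0.
move=> /mx_norm_neq0[[i j] /= Aij]; exists i, j.
move: Zk; rewrite -lecR (RRe_real (normr_real (phi (A k) : MV))).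
by rewrite -Aij.
Qed.

End Tame.

Theorem proposition10p6 (R : realType) (n : nat) (hn : (2 <= n)%N)
    (A B : nat -> 'M[R[i]]_n)
    (injA : injective A) (injB : injective B)
    (tameA : tame (SL R n) (range A)) (tameB : tame (SL R n) (range B)) :
  exists phi : 'M[R[i]]_n -> 'M[R[i]]_n,
    is_automorphism (SL R n) phi /\ forall k : nat, phi (A k) = B k.
Proof.
case: n hn A B injA injB tameA tameB => [|[|m]] // _ A B injA injB tameA tameB.
have [A1 [X [AX Xesc]]] := tame_corner injA tameA.
have [B1 [Y [BY Yesc]]] := tame_corner injB tameB.
have X1 := equivalent_SL A1 AX; have Y1 := equivalent_SL B1 BY.
apply: (equivalent_trans AX).
exact: equivalent_trans (corner_equivalent X1 Y1 Xesc Yesc) (equivalent_sym B1 BY).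
Qed.
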